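(* Let $n$ be an even positive integer. Let $p^{\mathrm{NC}}_{\mathrm{opt}}(n)$ denote the supremum, over all operational theories admitting a preparation-noncontextual ontological (hidden-variable) model and all parity-oblivious protocols for $\mathrm{HM}_n$ therein, of the probability that Bob outputs a correct edge and parity. Then $$p^{\mathrm{NC}}_{\mathrm{opt}}(n)=\tfrac12+\tfrac12R_n .$$
   Context: Let $[n]=\{1,\dots,n\}$, $\mathscr M_n$ the set of perfect matchings of $[n]$ (sets of $n/2$ disjoint pairs covering $[n]$), $\mathcal F_n=\{S\subseteq[n]:|S|\neq0,2\}$. For $g:\{\pm1\}^n\to\mathbb R$ let $\widehat g(S)=2^{-n}\sum_{\varepsilon\in\{\pm1\}^n}g(\varepsilon)\prod_{i\in S}\varepsilon_i$. Let $\mathcal K_n$ be the set of $g:\{\pm1\}^n\to\mathbb R$ with $g\ge0$ pointwise, $\widehat g(\emptyset)=1$, and $\widehat g(S)=0$ for all $S\in\mathcal F_n$. For $g\in\mathcal K_n$ let $\Phi(g)=\mathbb E_{\mathtt M}\big[\max_{e\in\mathtt M}|\widehat g(e)|\big]$ with $\mathtt M$ uniform on $\mathscr M_n$, and $R_n=\max_{g\in\mathcal K_n}\Phi(g)$. An operational theory consists of preparations and measurements with outcome distributions $p(k\mid P,M)$; probabilistic mixtures of preparations are preparations. An ontological model is a measurable space $\Lambda$ with probability measures $\mu_P$ (respecting mixtures: $\mu_{\sum_\alpha w_\alpha P_\alpha}=\sum_\alpha w_\alpha\mu_{P_\alpha}$) and measurable response functions $\xi(k\mid\lambda,M)\in[0,1]$,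 $\sum_k\xi(k\mid\lambda,M)=1$, with $p(k\mid P,M)=\int\xi(k\mid\lambda,M)\,d\mu_P(\lambda)$; it is preparation noncontextual if $\mu_P=\mu_{P'}$ whenever $p(k\mid P,M)=p(k\mid P',M)$ for all $M,k$. A protocol for $\mathrm{HM}_n$ consists of a preparation $P_x$ for each $x\in\{0,1\}^n$ and, for each $\mathtt M\in\mathscr M_n$, a measurement with outcomes $(\{i,j\},b)$, $\{i,j\}\in\mathtt M$, $b\in\{0,1\}$; the output is correct if $b=x_i\oplus x_j$. It is parity-oblivious if for all $S\in\mathcal F_n$, all measurements $M$ of the theory and outcomes $k$, $p(k\mid P_{S,0},M)=p(k\mid P_{S,1},M)$, where $P_{S,b}$ samples $x$ uniformly from $\{x:\bigoplus_{i\in S}x_i=b\}$ and implements $P_x$. The probability of a correct output is computed for $x$ uniform on $\{0,1\}^n$ and $\mathtt M$ independent and uniform on $\mathscr M_n$. *)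

(* Defs.v *)
(* Mathematical Components + MathComp-Analysis, over an arbitrary realType. *)
From mathcomp Require Import all_boot all_order all_algebra.
From mathcomp Require Import all_classical all_reals all_analysis.

Set Implicit Arguments.
Unset Strict Implicit.
Unset Printing Implicit Defensive.

Import Order.TTheory GRing.Theory Num.Theory.
Import numFieldNormedType.Exports.

Local Open Scope classical_set_scope.
Local Open Scope ring_scope.

(* The index set [n] is 'I_n.  The same type serves for {0,1}^n and for
   {+1,-1}^n: in the latter role x stands for the sign vector whose i-th entry
   is (-1)^(x i). *)
Notation cube n := {ffun 'I_n -> bool}.

Definition parity (n : nat) (S : {set 'I_n}) (x : cube n) : bool :=
  \big[addb/false]_(i in S) x i.

Definition perfect_matching (n : nat) (M : {set {set 'I_n}}) : bool :=
  finset.partition M [set: 'I_n]%SET && [forall e in M, #|e| == 2%N].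

Notation matching n := {M : {set {set 'I_n}} | perfect_matching M}.

Notation edge M := {e | e \in val M}.

Definition oblivious_family (n : nat) (S : {set 'I_n}) : bool :=
  (#|S| != 0%N) && (#|S| != 2%N).

Definition fourier (R : realType) (n : nat) (g : cube n -> R) (S : {set 'I_n})
    : R :=
  (2 ^+ n)^-1 * \sum_(x : cube n) g x * \prod_(i in S) (-1) ^+ x i.

Definition K_set (R : realType) (n : nat) : set (cube n -> R) :=
  [set g | [/\ forall x, 0 <= g x, fourier g finset.set0 = 1 &
               forall S, oblivious_family S -> fourier g S = 0]].

(* The base value 0 of the iterated maximum is harmless: all terms are
   nonnegative, and a matching of a nonempty set is nonempty. *)
Definition Phi (R : realType) (n : nat) (g : cube n -> R) : R :=
  #|{: matching n}|%:R^-1 *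
  \sum_(M : matching n) \big[Num.max/0]_(e in val M) `|fourier g e|.

(* This supremum is attained: see R_max_attained below. *)
Definition R_max (R : realType) (n : nat) : R := sup (@Phi R n @` @K_set R n).

Definition is_distr (R : realType) (A : finType) (w : A -> R) : Prop :=
  (forall a, 0 <= w a) /\ \sum_a w a = 1.

(* Outcome sets are discrete but may be infinite, so that total probability is
   an unordered sum.  The preparation mix w P chooses a with probability w a
   and then performs P a; it is only meaningful when w is a distribution. *)
Record op_theory (R : realType) := OpTheory {
  Prep : Type;
  Meas : Type;
  Out : Meas -> choiceType;
  prob : Prep -> forall M : Meas, Out M -> R;
  prob_ge0 : forall P M k, 0 <= @prob P M k;
  prob_sum1 : forall P M, \esum_(k in [set: Out M]) (@prob P M k)%:E = 1%E;
  mix : forall A : finType, (A -> R) -> (A -> Prep) -> Prep;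
  prob_mix : forall (A : finType) (w : A -> R) (P : A -> Prep), is_distr w ->
    forall M k, @prob (mix w P) M k = \sum_a w a * @prob (P a) M k }.

Arguments Out {R} _ _.
Arguments prob {R} _ _ _ _.
Arguments mix {R} _ {A} _ _.

Record ontological_model (R : realType) (T : op_theory R) := OntologicalModel {
  om_display : measure_display;
  Lambda : measurableType om_display;
  mu : Prep T -> probability Lambda R;
  xi : forall M : Meas T, Out T M -> Lambda -> R;
  xi_measurable : forall M k, measurable_fun [set: Lambda] (@xi M k);
  xi_ge0 : forall M k l, 0 <= @xi M k l;
  xi_le1 : forall M k l, @xi M k l <= 1;
  xi_sum1 : forall M l, \esum_(k in [set: Out T M]) (@xi M k l)%:E = 1%E;
  mu_mix : forall (A : finType) (w : A -> R) (P : A -> Prep T), is_distr w ->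
    forall B, measurable B ->
      mu (mix T w P) B = (\sum_a (w a)%:E * mu (P a) B)%E;
  xi_prob : forall P M k,
    (prob T P M k)%:E = (\int[mu P]_l (@xi M k l)%:E)%E }.

(* Measures are compared on measurable sets, the only ones on which the values
   of a MathComp-Analysis measure are constrained. *)
Definition preparation_noncontextual (R : realType) (T : op_theory R)
    (O : ontological_model T) : Prop :=
  forall P P' : Prep T,
    (forall M k, prob T P M k = prob T P' M k) ->
    forall B, measurable B -> mu O P B = mu O P' B.

(* hm_out labels the outcomes of the measurement attached to a matching M by
   the pairs (e, b) with e an edge of M and b a bit. *)
Record HM_protocol (R : realType) (T : op_theory R) (n : nat) := HMProtocol {
  hm_prep : cube n -> Prep T;
  hm_meas : matching n -> Meas T;
  hm_out : forall M : matching n, edge M * bool -> Out T (hm_meas M);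
  hm_out_bij : forall M, bijective (@hm_out M) }.

Definition unif_parity (R : realType) (n : nat) (S : {set 'I_n}) (b : bool)
    (x : cube n) : R :=
  if parity S x == b then #|[pred y : cube n | parity S y == b]|%:R^-1 else 0.

Definition parity_prep (R : realType) (T : op_theory R) (n : nat)
    (H : HM_protocol T n) (S : {set 'I_n}) (b : bool) : Prep T :=
  mix T (@unif_parity R n S b) (hm_prep H).

Definition parity_oblivious (R : realType) (T : op_theory R) (n : nat)
    (H : HM_protocol T n) : Prop :=
  forall S : {set 'I_n}, oblivious_family S -> forall M k,
    prob T (parity_prep H S false) M k = prob T (parity_prep H S true) M k.

Definition success_prob (R : realType) (T : op_theory R) (n : nat)
    (H : HM_protocol T n) : R :=
  (2 ^+ n)^-1 * \sum_(x : cube n)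
    (#|{: matching n}|%:R^-1 * \sum_(M : matching n) \sum_(e : edge M)
      prob T (hm_prep H x) (hm_meas H M) (hm_out H (e, parity (val e) x))).

Definition p_NC_opt (R : realType) (n : nat) : R :=
  sup [set v | exists T : op_theory R,
    (exists O : ontological_model T, preparation_noncontextual O) /\
    (exists2 H : HM_protocol T n, parity_oblivious H & v = success_prob H)].

Lemma sumr_continuous (T : topologicalType) (R : realType) (I : Type) (r : seq I)
    (P : pred I) (F : I -> T -> R) :
  (forall i, continuous (F i)) -> continuous (fun x => \sum_(j <- r | P j) F j x).
Proof.
move=> cF; elim: r => [|i r IH].
  rewrite (_ : (fun=> _) = cst 0); first exact: cst_continuous.
  by apply/funext => x; rewrite big_nil.
case Pi : (P i); last first.
  rewrite (_ : (fun=> _) = fun x => \sum_(j <- r | P j) F j x)//.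
  by apply/funext => x; rewrite big_cons Pi.
rewrite (_ : (fun=> _) = fun x => F i x + \sum_(j <- r | P j) F j x).
  move=> x; by apply: cvgD; [exact: cF|exact: IH].
by apply/funext => x; rewrite big_cons Pi.
Qed.

Lemma bigmaxr_continuous (T : topologicalType) (R : realType) (I : Type) (r : seq I)
    (P : pred I) (F : I -> T -> R) :
  (forall i, continuous (F i)) -> continuous (fun x => \big[Num.max/0]_(j <- r | P j) F j x).
Proof.
move=> cF; elim: r => [|i r IH].
  rewrite (_ : (fun=> _) = cst 0); first exact: cst_continuous.
  by apply/funext => x; rewrite big_nil.
case Pi : (P i); last first.
  rewrite (_ : (fun=> _) = fun x => \big[Num.max/0]_(j <- r | P j) F j x)//.
  by apply/funext => x; rewrite big_cons Pi.
rewrite (_ : (fun=> _) = F i \max (fun x => \big[Num.max/0]_(j <- r | P j) F j x)).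
  move=> x; by apply: continuous_max; [exact: cF|exact: IH].
by apply/funext => x; rewrite big_cons Pi.
Qed.

Lemma fourier_continuous (R : realType) (n : nat) (T : topologicalType)
    (ev : T -> cube n -> R) (evc : forall x, continuous (ev ^~ x))
    (S : {set 'I_n}) :
  continuous (fun t => fourier (ev t) S).
Proof.
move=> t; apply: cvgM; first exact: cvg_cst.
apply: (sumr_continuous (F := fun x t => ev t x * _)) => x u.
by apply: cvgM; [exact: evc|exact: cvg_cst].
Qed.

Lemma Phi_continuous (R : realType) (n : nat) (T : topologicalType)
    (ev : T -> cube n -> R) (evc : forall x, continuous (ev ^~ x)) :
  continuous (fun t => Phi (ev t)).
Proof.
move=> t; apply: cvgM; first exact: cvg_cst.
pose G (M : matching n) u : R := \big[Num.max/0]_(e in val M) `|fourier (ev u) e|.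
have cG M : continuous (G M).
  apply: (@bigmaxr_continuous T R _ _ _ (fun e u => `|fourier (ev u) e|)) => e v.
  by apply: cvg_norm; exact: (fourier_continuous evc).
exact: (@sumr_continuous T R _ _ xpredT G cG t).
Qed.

Lemma fourier_set0E (R : realType) (n : nat) (g : cube n -> R) :
  fourier g finset.set0 = (2 ^+ n)^-1 * \sum_x g x.
Proof.
by congr (_ * _); apply: eq_bigr => x _; rewrite big_set0 mulr1.
Qed.

Lemma K_set_compact (R : realType) (n : nat) :
  @compact (prod_topology (fun _ : cube n => R)) (@K_set R n).
Proof.
pose T : topologicalType := prod_topology (fun _ : cube n => R).
pose ev (g : T) : cube n -> R := g.
have evc x : continuous (ev ^~ x) by exact: (@proj_continuous _ (fun=> R) x).
have two0 : (2 ^+ n : R) != 0 by rewrite expf_neq0// pnatr_eq0.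
pose B : set T := [set f | forall x, `[0, 2 ^+ n]%classic (f x)].
have cB : compact B.
  by apply: (@tychonoff _ (fun=> R) (fun=> `[0, 2 ^+ n]%classic)) => x;
     exact: segment_compact.
apply: (subclosed_compact _ cB); last first.
  move=> g [g0 g1 _] x; rewrite /= in_itv/= g0/=.
  have -> : 2 ^+ n = \sum_y g y :> R.
    move: g1; rewrite fourier_set0E => /(canRL (mulKf _)) ->.
      by rewrite mulr1 invrK.
    by rewrite invr_eq0.
  by rewrite (bigD1 x)//= lerDl sumr_ge0.
pose A1 := \bigcap_(x in [set: cube n]) (ev ^~ x) @^-1` [set t | 0 <= t].
pose A2 := (fun t => fourier (ev t) finset.set0) @^-1` [set t | t = 1].
pose A3 := \bigcap_(S in [set S : {set 'I_n} | oblivious_family S])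
  (fun t => fourier (ev t) S) @^-1` [set t | t = 0].
have -> : @K_set R n = A1 `&` A2 `&` A3.
  apply/seteqP; split=> g.
    by case=> g0 g1 gS; split; [split|] => // x _; exact: g0.
  by case=> -[g0 g1] gS; split=> // x; exact: g0.
apply: closedI; first apply: closedI.
- apply: closed_bigI => x _; apply: preimage_closed; last exact: closed_ge.
  by move=> g _; exact: evc.
- apply: preimage_closed; last exact: closed_eq.
  by move=> g _; exact: (fourier_continuous evc).
- apply: closed_bigI => S _; apply: preimage_closed; last exact: closed_eq.
  by move=> g _; exact: (fourier_continuous evc).
Qed.

Lemma K_set_nonempty (R : realType) (n : nat) : @K_set R n !=set0.
Proof.
have two0 : (2 ^+ n : R) != 0 by rewrite expf_neq0// pnatr_eq0.
exists (fun=> 1); split=> [x|//|S].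
- exact: ler01.
- rewrite fourier_set0E sumr_const card_ffun card_bool card_ord natrX.
  by rewrite mulVf.
- case/andP; rewrite cards_eq0 => /set0Pn[i iS] _.
  pose h (x : cube n) : cube n := [ffun j => if j == i then ~~ x j else x j].
  have hK : involutive h.
    by move=> x; apply/ffunP => j; rewrite !ffunE; case: eqP; rewrite ?negbK.
  rewrite /fourier; set s := \sum_x _; suff -> : s = 0 by rewrite mulr0.
  have sN : s = - s.
    rewrite {1}/s (reindex_inj (inv_inj hK)) /s -sumrN; apply: eq_bigr => x _.
    rewrite !mul1r (bigD1 i)//= [in RHS](bigD1 i)//= ffunE eqxx signrN mulNr.
    congr (- (_ * _)); apply: eq_bigr => j /andP[_ /negPf ji].
    by rewrite ffunE ji.
  have /eqP : s *+ 2 = 0 by rewrite mulr2n {1}sN addNr.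
  by rewrite mulrn_eq0 => /eqP.
Qed.

Lemma R_max_attained (R : realType) (n : nat) :
  exists2 g : cube n -> R, @K_set R n g &
    Phi g = R_max R n /\ forall h : cube n -> R, K_set h -> Phi h <= Phi g.
Proof.
pose T : topologicalType := prod_topology (fun _ : cube n => R).
have cPhi : continuous (@Phi R n : T -> R).
  apply: (@Phi_continuous R n T (fun g => g)) => x.
  exact: (@proj_continuous _ (fun=> R) x).
have [c cK cmax] := @compact_EVT_max T R (@Phi R n) (@K_set R n)
  (@K_set_nonempty R n) (@K_set_compact R n) (continuous_subspaceT cPhi).
exists c; first exact/set_mem.
have ub (h : cube n -> R) : K_set h -> Phi h <= Phi c.
  by move=> Kh; apply: cmax; exact/mem_set.
split=> //; apply/eqP; rewrite eq_le; apply/andP; split.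
  apply: ub_le_sup; last by exists c => //; exact/set_mem.
  by exists (Phi c) => _ [h Kh <-]; exact: ub.
apply: ge_sup; first by exists (Phi c), c => //; exact/set_mem.
by move=> _ [h Kh <-]; exact: ub.
Qed.

(* Main.v *)
(* Upper bound.  Noncontextuality turns parity-obliviousness into linear
   relations between the measures mu_x of the preparations P_x.  Let m be their
   mean and h_x the density of mu_x with respect to m.  For almost every
   ontological state l the function x |-> h_x(l) lies in K_n, and the conditional
   probability of success at l is at most 1/2 + Phi(h(l))/2, because an answer
   (e, b) is correct with probability (1 + (-1)^b h(l)^(e))/2.

   Lower bound.  For a maximiser g of Phi, prepare the ontological state l with
   probability g(x + l)/2^n and answer with the edge e of M maximising |g^(e)| and
   the parity of l on e, corrected by the sign of g^(e).  A further measurement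
   reveals l, so that operational equivalence is equality and the model is
   trivially noncontextual. *)
From HB Require Import structures.
Require Import Defs.
From mathcomp Require Import all_boot all_order all_algebra.
From mathcomp Require Import all_classical all_reals all_analysis.
From mathcomp Require Import measurable_realfun.
From mathcomp Require Import ring lra zify.

Set Implicit Arguments.
Unset Strict Implicit.
Unset Printing Implicit Defensive.

Import Order.TTheory GRing.Theory Num.Theory.
Local Open Scope ring_scope.

(** * Parities, Fourier coefficients and matchings *)

Lemma prod_sign_parity (R : realType) (n : nat) (S : {set 'I_n}) (x : cube n) :
  \prod_(i in S) (-1) ^+ x i = (-1) ^+ parity S x :> R.
Proof.
rewrite /parity; apply: esym.
by apply: (big_morph (fun b : bool => (-1) ^+ b : R)) => // b c; rewrite signr_addb.
Qed.

Lemma fourierE (R : realType) (n : nat) (g : cube n -> R) (S : {set 'I_n}) :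
  fourier g S = (2 ^+ n)^-1 * \sum_x g x * (-1) ^+ parity S x.
Proof. by congr (_ * _); apply: eq_bigr => x _; rewrite prod_sign_parity. Qed.

(** In the sign picture this is the pointwise product, so parities become characters of the
    group. *)
Definition cube_add {n : nat} (x y : cube n) : cube n := [ffun i => x i (+) y i].

Lemma cube_addC (n : nat) : commutative (@cube_add n).
Proof. by move=> x y; apply/ffunP => i; rewrite !ffunE addbC. Qed.

Lemma cube_addK (n : nat) (y : cube n) : involutive (cube_add y).
Proof. by move=> x; apply/ffunP => i; rewrite !ffunE addKb. Qed.

Lemma parity_add (n : nat) (S : {set 'I_n}) (x y : cube n) :
  parity S (cube_add x y) = parity S x (+) parity S y.
Proof. by rewrite /parity -big_split; apply: eq_bigr => i _; rewrite ffunE. Qed.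

Lemma parity_surj (n : nat) (S : {set 'I_n}) : S != finset.set0 ->
  exists x : cube n, parity S x.
Proof.
case/set0Pn => i iS; exists [ffun j => j == i].
rewrite /parity (bigD1 i)//= ffunE eqxx big1// => j /andP[_ /negPf ji].
by rewrite ffunE ji.
Qed.

(** Translation by a vector of odd parity on [S] exchanges the two parity classes. *)
Lemma card_parity (n : nat) (S : {set 'I_n}) : S != finset.set0 ->
  #|[pred y : cube n | parity S y == false]|
    = #|[pred y : cube n | parity S y == true]|.
Proof.
move=> /parity_surj[z Sz]; rewrite -!sum1_card.
rewrite (reindex_inj (inv_inj (cube_addK z))); apply: eq_bigl => x.
by rewrite !inE parity_add Sz; case: (parity S x).
Qed.

Lemma card_parity_gt0 (n : nat) (S : {set 'I_n}) (b : bool) :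
  S != finset.set0 -> (0 < #|[pred y : cube n | parity S y == b]|)%N.
Proof.
move=> S0; have [z Sz] := parity_surj S0.
suff : (0 < #|[pred y : cube n | parity S y == true]|)%N.
  by case: b => //; rewrite card_parity.
by apply/card_gt0P; exists z; rewrite inE Sz.
Qed.

Lemma is_distr_unif_parity (R : realType) (n : nat) (S : {set 'I_n}) (b : bool) :
  S != finset.set0 -> is_distr (@unif_parity R n S b).
Proof.
move=> S0; split=> [x|].
  by rewrite /unif_parity; case: ifP => // _; rewrite invr_ge0.
rewrite /unif_parity -big_mkcond/= sumr_const -[LHS]mulr_natl divff//.
by rewrite pnatr_eq0 -lt0n card_parity_gt0.
Qed.

(** The parity classes have equal size, so the two uniform distributions differ by a multiple of the
    character of [S]. Obliviousness thereby becomes the vanishing of a Fourier coefficient. *)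
Lemma unif_parity_sub (R : realType) (n : nat) (S : {set 'I_n}) (x : cube n) :
  S != finset.set0 ->
  unif_parity R S false x - unif_parity R S true x
    = #|[pred y : cube n | parity S y == true]|%:R^-1 * (-1) ^+ parity S x.
Proof.
move=> S0; rewrite /unif_parity card_parity//.
by case: (parity S x); rewrite /= ?sub0r ?subr0 ?mulrN ?mulr1.
Qed.

(** The indicator of parity [b] is half of 1 plus [(-1) ^+ b] times the character of [S]. *)
Lemma mean_parity_eq (R : realType) (n : nat) (g : cube n -> R) (S : {set 'I_n})
    (b : bool) : fourier g finset.set0 = 1 ->
  (2 ^+ n)^-1 * \sum_x g x * (parity S x == b)%:R
    = (1 + (-1) ^+ b * fourier g S) / 2.
Proof.
rewrite fourier_set0E => g1; rewrite fourierE -[X in X + _]g1 mulrCA -mulrDr -mulrA.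
congr (_ * _); rewrite mulr_sumr -big_split mulr_suml; apply: eq_bigr => x _ /=.
by case: (parity S x) b => -[]//=; rewrite ?expr0 ?expr1; field.
Qed.

Lemma perfect_matching_exists (n : nat) : ~~ odd n ->
  exists M : {set {set 'I_n}}, perfect_matching M.
Proof.
move=> n_even.
(* The fibres of halving are the pairs {2k, 2k+1}; evenness of [n] keeps 2k+1 below [n]. *)
pose f (i : 'I_n) := (i : nat)./2.
exists (preim_partition f [set: 'I_n]%SET).
rewrite /perfect_matching preim_partitionP/=; apply/forall_inP => e.
case/imsetP => i _ ->{e}.
have lt0 : ((f i).*2 < n)%N by have := ltn_ord i; rewrite /f; lia.
have lt1 : ((f i).*2.+1 < n)%N by have := ltn_ord i; rewrite /f; lia.
rewrite (_ : [set _ in _ | _]%SET = [set Ordinal lt0; Ordinal lt1]%SET).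
  by rewrite cards2 -val_eqE/=; lia.
apply/setP => j; rewrite !inE -!val_eqE/= /f; apply/idP/idP; lia.
Qed.

Lemma perfect_matching_nonempty (n : nat) (M : matching n) : (0 < n)%N ->
  exists e, e \in val M.
Proof.
case: n M => // n [M /= /andP[/andP[/eqP cM _] _]] _.
have : ord0 \in finset.cover M by rewrite cM inE.
by case/bigcupP => e; exists e.
Qed.

Lemma bigmax_attained (R : realType) (I : finType) (A : {pred I}) (F : I -> R)
    (i0 : I) : i0 \in A -> (forall i, 0 <= F i) ->
  exists2 i, i \in A & \big[Num.max/0]_(j in A) F j = F i.
Proof.
move=> i0A F0; have [i iA imax] := arg_maxP F i0A; exists i => //.
apply/le_anti/andP; split; last exact: le_bigmax_cond.
by apply: bigmax_le => // j; exact: imax.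
Qed.

(** Once the correct answer for x is encoded by an indicator, x no longer enters the argument of
    [p], and the sums over x and over answers can be exchanged. *)
Lemma sum_graphE (R : realType) (E : finType) (p : E * bool -> R) (b : E -> bool) :
  \sum_e p (e, b e) = \sum_k p k * (b k.1 == k.2)%:R.
Proof.
transitivity (\sum_e \sum_c p (e, c) * (b e == c)%:R).
  apply: eq_bigr => e _; rewrite big_bool/=.
  by case: (b e); rewrite ?mulr1 ?mulr0 ?addr0 ?add0r.
by rewrite pair_bigA; apply: eq_bigr => -[].
Qed.

(* [p k] is the probability of answering [k] at a fixed ontological state, and
   [g / 2 ^+ n] the conditional distribution of [x] there. *)
Lemma mean_success_le (R : realType) (n : nat) (g : cube n -> R) (M : matching n)
    (p : edge M * bool -> R) :
  fourier g finset.set0 = 1 -> (forall k, 0 <= p k) -> \sum_k p k = 1 ->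
  (2 ^+ n)^-1 * \sum_x g x * \sum_(e : edge M) p (e, parity (val e) x)
    <= 1 / 2 + 1 / 2 * \big[Num.max/0]_(e in val M) `|fourier g e|.
Proof.
move=> g1 p0 p1; set m := \big[Num.max/0]_(_ in _) _.
have -> : (2 ^+ n)^-1 * (\sum_x g x * \sum_(e : edge M) p (e, parity (val e) x))
   = \sum_(k : edge M * bool) p k * ((1 + (-1) ^+ k.2 * fourier g (val k.1)) / 2).
  under eq_bigr => x _ do
    rewrite (sum_graphE p (fun e : edge M => parity (val e) x)) mulr_sumr.
  rewrite exchange_big mulr_sumr; apply: eq_bigr => k _ /=.
  rewrite -mean_parity_eq// [RHS]mulrCA; congr (_ * _); rewrite mulr_sumr.
  by apply: eq_bigr => x _; rewrite mulrCA.
(* The bound is spread over the answers with the weights [p], which sum to 1, and compared answer by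
   answer. *)
rewrite -[leRHS]mul1r -[X in _ <= X * _]p1 mulr_suml; apply: ler_sum => k _.
apply: ler_wpM2l => //; case: k => -[e eM] b /=.
have fm : `|fourier g e| <= m by exact: le_bigmax_cond.
have : (-1) ^+ b * fourier g e <= `|fourier g e|.
  by rewrite (le_trans (ler_norm _))// normrM normr_sign mul1r.
lra.
Qed.

Lemma success_le (R : realType) (n : nat) (g : cube n -> R)
    (p : forall M : matching n, edge M * bool -> R) :
  (0 < #|{: matching n}|)%N -> K_set g ->
  (forall M k, 0 <= p M k) -> (forall M, \sum_k p M k = 1) ->
  (2 ^+ n)^-1 * \sum_x (#|{: matching n}|%:R^-1 * \sum_(M : matching n)
      \sum_(e : edge M) g x * p M (e, parity (val e) x))
    <= 1 / 2 + 1 / 2 * R_max R n.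
Proof.
move=> N_gt0 [g0 g1 gS] p0 p1; set N : R := #|_|%:R.
have N0 : 0 < N by rewrite ltr0n.
have Phi_le : Phi g <= R_max R n.
  by have [h _ [<- hmax]] := R_max_attained R n; exact: hmax.
apply: (@le_trans _ _ (1 / 2 + 1 / 2 * Phi g)); last by lra.
rewrite -mulr_sumr mulrCA exchange_big mulr_sumr.
(* Clearing the factor 1/N turns the constant 1/2 into a sum over the N matchings, which are then
   compared one by one. *)
rewrite -(ler_pM2l N0) mulVKf ?gt_eqF// mulrDr /Phi.
rewrite [N * (_ / _ * _)]mulrCA mulVKf ?gt_eqF//.
rewrite (_ : N * (1 / 2) = \sum_(M : matching n) 1 / 2); last first.
  by rewrite sumr_const -[RHS]mulr_natl.
rewrite mulr_sumr -big_split; apply: ler_sum => M _ /=.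
rewrite -(eq_bigr _ (fun x _ => mulr_sumr _ _ _ (g x))).
exact: mean_success_le.
Qed.

(** * Densities and integral representations *)

Lemma esum_finType (R : realType) (I : finType) (a : I -> R) :
  (forall i, 0 <= a i) ->
  (\esum_(i in [set: I]) (a i)%:E = (\sum_i a i)%:E)%E.
Proof.
move=> a0; have Ifin : finite_set [set: I] by exact: finite_finset.
rewrite esum_fset//; last by move=> i _; rewrite lee_fin.
rewrite fsumEFin// [in RHS]fsbig_seq ?index_enum_uniq//.
by congr EFin; apply: eq_fsbigl; apply/esym/seteqP; split=> i //= _;
  exact: mem_index_enum.
Qed.

Section densities.
Context d (L : measurableType d) (R : realType).
Variable m : {finite_measure set L -> \bar R}.
Variables (I : finType) (nu : I -> {finite_measure set L -> \bar R}).
Hypothesis nu_m : forall i, (nu i) `<< m.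

(** These are Radon-Nikodym derivatives. The chosen versions are finite and nonnegative everywhere,
    so [fine] loses nothing, and [fourier] can be applied to their real values at each state. *)
Lemma exists_density : exists h : I -> L -> R,
  [/\ forall i l, 0 <= h i l,
      forall i, m.-integrable [set: L] (EFin \o h i),
      forall i B, measurable B -> ((nu i) B = \int[m]_(l in B) (h i l)%:E)%E &
      forall i (f : L -> R), (forall l, 0 <= f l) -> measurable_fun [set: L] f ->
        (\int[nu i]_l (f l)%:E = \int[m]_l (f l * h i l)%:E)%E].
Proof.
pose f i := Radon_Nikodym_SigmaFinite.f (nu i) m.
have f_fin i l : f i l \is a fin_num by exact: Radon_Nikodym_SigmaFinite.f_fin_num.
have f0 i l : (0 <= f i l)%E by exact: Radon_Nikodym_SigmaFinite.f_ge0.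
have fE i : EFin \o (fun l => fine (f i l)) = f i.
  by apply/funext => l /=; rewrite fineK.
exists (fun i l => fine (f i l)); split.
- by move=> i l; rewrite fine_ge0.
- by move=> i; rewrite fE; exact: Radon_Nikodym_SigmaFinite.f_integrable.
- move=> i B mB; rewrite (Radon_Nikodym_SigmaFinite.f_integral (nu_m i))//.
  by apply: eq_integral => l _; rewrite fineK.
- move=> i g g0 mg.
  rewrite -(Radon_Nikodym_SigmaFinite.change_of_variables (nu_m i))//.
  + by apply: eq_integral => l _; rewrite EFinM fineK.
  + exact/measurable_EFinP.
Qed.

(** Integrable functions with equal integrals over every measurable set agree almost everywhere. The
    case [c = 1] will normalise the densities; [c = 0] will give their Fourier conditions. *)
Lemma density_ae_comb (h : I -> L -> R) (a : I -> R) (c : R) :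
  (forall i, m.-integrable [set: L] (EFin \o h i)) ->
  (forall i B, measurable B -> ((nu i) B = \int[m]_(l in B) (h i l)%:E)%E) ->
  (forall B, measurable B -> (\sum_i (a i)%:E * nu i B = c%:E * m B)%E) ->
  {ae m, forall l, \sum_i a i * h i l = c}.
Proof.
move=> ih nuE aE.
have iah i : m.-integrable [set: L] (fun l => (a i)%:E * (h i l)%:E)%E.
  exact: integrableZl (ih i).
have : ae_eq m setT (fun l => \sum_i (a i)%:E * (h i l)%:E)%E (cst c%:E).
  apply: integral_ae_eq => //.
  - exact: integrable_sum.
  - move=> E _ mE; rewrite integral_cst// -aE//.
    rewrite integral_sum//; last by move=> i; exact: integrableS (iah i).
    apply: eq_bigr => i _; rewrite nuE// integralZl//; exact: integrableS (ih i).
apply: filterS => l /(_ Logic.I)/=.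
by under eq_bigr do rewrite -EFinM; rewrite sumEFin => -[].
Qed.
End densities.

Section integral_representation.
Context d (L : measurableType d) (R : realType).
Variable m : {measure set L -> \bar R}.

(** Measurability and nonnegativity travel with the integral formula, so that the nested sums of a
    success probability can be treated one layer at a time. *)
Definition repr_by (v : R) (f : L -> R) :=
  [/\ measurable_fun [set: L] f, forall l, 0 <= f l & v%:E = (\int[m]_l (f l)%:E)%E].

Lemma repr_by_scale (c v : R) (f : L -> R) : 0 <= c -> repr_by v f ->
  repr_by (c * v) (fun l => c * f l).
Proof.
move=> c0 [mf f0 vE]; split.
- exact: measurable_funM.
- by move=> l; rewrite mulr_ge0.
- under eq_integral do rewrite EFinM.
  rewrite ge0_integralZl_EFin -?vE//; first by move=> l _; rewrite lee_fin.
  exact/measurable_EFinP.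
Qed.

Lemma repr_by_sum (I : finType) (v : I -> R) (f : I -> L -> R) :
  (forall i, repr_by (v i) (f i)) ->
  repr_by (\sum_i v i) (fun l => \sum_i f i l).
Proof.
move=> vf; split.
- by apply: measurable_sum => i; case: (vf i).
- by move=> l; apply: sumr_ge0 => i _; case: (vf i).
- under eq_integral do rewrite -sumEFin.
  rewrite ge0_integral_sum//.
  + by rewrite -sumEFin; apply: eq_bigr => i _; case: (vf i).
  + by move=> i; apply/measurable_EFinP; case: (vf i).
  + by move=> i l _; rewrite lee_fin; case: (vf i).
Qed.

Lemma repr_by_le (v c : R) (f : L -> R) : m setT = 1%E -> 0 <= c -> repr_by v f ->
  {ae m, forall l, f l <= c} -> v <= c.
Proof.
move=> m1 c0 [mf f0 vE] fc; rewrite -lee_fin vE.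
rewrite -[leRHS]mule1 -m1 -integral_cst//.
apply: ae_ge0_le_integral => //.
- by move=> l _; rewrite lee_fin.
- exact/measurable_EFinP.
- by apply: filterS fc => l; rewrite lee_fin.
Qed.
End integral_representation.

(** * The upper bound *)

Lemma R_max_ge0 (R : realType) (n : nat) : 0 <= R_max R n.
Proof.
have [g _ [<- _]] := R_max_attained R n; rewrite /Phi mulr_ge0// sumr_ge0// => M _.
by rewrite bigmax_ge_id.
Qed.

Lemma is_distr_unif (R : realType) (n : nat) :
  is_distr (fun _ : cube n => (2 ^+ n)^-1 : R).
Proof.
split=> [x|]; first by rewrite invr_ge0 exprn_ge0.
rewrite sumr_const card_ffun card_bool card_ord -[LHS]mulr_natl natrX.
by rewrite mulfV// expf_neq0// pnatr_eq0.
Qed.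

Section upper_bound.
Variables (R : realType) (T : op_theory R) (n : nat) (O : ontological_model T).
Hypothesis O_nc : preparation_noncontextual O.
Variable H : HM_protocol T n.
Hypothesis H_po : parity_oblivious H.

(** The uniform mixture is itself a preparation, so the mean measure comes as a probability
    measure. *)
Let m := mu O (mix T (fun _ : cube n => (2 ^+ n)^-1 : R) (hm_prep H)).
Let nu x := mu O (hm_prep H x).

Lemma mean_muE B : measurable B -> (m B = \sum_x ((2 ^+ n)^-1 : R)%:E * nu x B)%E.
Proof. by move=> mB; rewrite /m mu_mix//; exact: is_distr_unif. Qed.

(** A sum of nonnegative terms with positive weights vanishes only if every term does. *)
Lemma mu_dominated x : nu x `<< m.
Proof.
apply/null_content_dominatesP => B mB mB0; have := mean_muE mB.
rewrite [LHS]mB0 => /esym/eqP; rewrite seq_psume_eq0 => [|y _]; last first.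
  by rewrite mule_ge0// lee_fin invr_ge0 exprn_ge0.
move=> /allP/(_ x (mem_index_enum x))/=; rewrite mule_eq0 => /orP[|/eqP//].
by rewrite eqe invr_eq0 expf_eq0 pnatr_eq0 andbF.
Qed.

(** Obliviousness makes the two parity mixtures operationally equivalent, noncontextuality equates
    their measures, and their weights differ by a multiple of the character of [S]. *)
Lemma alternating_mu0 (S : {set 'I_n}) B : oblivious_family S -> measurable B ->
  (\sum_x ((-1) ^+ parity S x : R)%:E * nu x B = 0)%E.
Proof.
move=> Sobl mB; have S0 : S != finset.set0.
  by case/andP: Sobl; rewrite cards_eq0.
(* Finite values allow the two mixtures to be subtracted in [R]. *)
have nuE x : nu x B = (fine (nu x B))%:E by rewrite fineK// fin_num_measure.
have : mu O (parity_prep H S false) B = mu O (parity_prep H S true) B.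
  by apply: O_nc => // M k; exact: H_po.
rewrite /parity_prep !mu_mix//; try exact: is_distr_unif_parity.
under eq_bigr do rewrite -/(nu _) nuE -EFinM.
under [RHS]eq_bigr do rewrite -/(nu _) nuE -EFinM.
under [X in _ -> X = _]eq_bigr do rewrite nuE -EFinM.
rewrite !sumEFin => -[] /eqP; rewrite -subr_eq0 -sumrB.
under eq_bigr do rewrite -mulrBl unif_parity_sub// -mulrA.
rewrite -mulr_sumr mulf_eq0 invr_eq0 pnatr_eq0 -leqn0 leqNgt card_parity_gt0//=.
by move=> /eqP ->.
Qed.

Lemma response_sum1 (M : matching n) l :
  \sum_(k : edge M * bool) xi (o := O) (hm_out H k) l = 1.
Proof.
have := xi_sum1 (o := O) (hm_meas H M) l.
rewrite (reindex_esum [set: edge M * bool] setT (@hm_out _ _ _ H M)); last first.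
  by rewrite setTT_bijective; exact: hm_out_bij.
by rewrite esum_finType => [[]|k]//; exact: xi_ge0.
Qed.

Lemma success_prob_le : (0 < #|{: matching n}|)%N ->
  success_prob H <= 1 / 2 + 1 / 2 * R_max R n.
Proof.
move=> N_gt0.
have [h [h0 ih hE hint]] := exists_density mu_dominated.
(* [W] mirrors the nesting of [success_prob], each probability being replaced by density times
   response. *)
pose W l := (2 ^+ n)^-1 * \sum_x (#|{: matching n}|%:R^-1 * \sum_(M : matching n)
      \sum_(e : edge M) h x l * xi (o := O) (hm_out H (e, parity (val e) x)) l).
have WE : repr_by m (success_prob H) W.
  apply: repr_by_scale; first by rewrite invr_ge0 exprn_ge0.
  apply: repr_by_sum => x; apply: repr_by_scale; first by rewrite invr_ge0.
  apply: repr_by_sum => M; apply: repr_by_sum => e; split.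
  - apply: measurable_funM; last exact: xi_measurable.
    by apply/measurable_EFinP; exact: measurable_int (ih x).
  - by move=> l; rewrite mulr_ge0// xi_ge0.
  - rewrite (xi_prob O) hint//; last 2 first.
    + by move=> l; exact: xi_ge0.
    + exact: xi_measurable.
    by apply: eq_integral => l _; rewrite mulrC.
apply: (repr_by_le _ _ WE).
- exact: probability_setT.
- by have := R_max_ge0 R n; lra.
have h1 : {ae m, forall l, fourier (h ^~ l) finset.set0 = 1}.
  have /filterS : {ae m, forall l, \sum_x (2 ^+ n)^-1 * h x l = 1}.
    by apply: density_ae_comb ih hE _ => B mB; rewrite mul1e -mean_muE.
  by apply => l; rewrite fourier_set0E mulr_sumr.
(* The condition on [S] sits inside the almost-everywhere statement, so that the exceptional sets of
   all the finitely many [S] can be united. *)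
have hS S : {ae m, forall l, oblivious_family S -> fourier (h ^~ l) S = 0}.
  have [Sobl|Sobl] := boolP (oblivious_family S); last exact: aeW.
  have /filterS : {ae m, forall l, \sum_x (-1) ^+ parity S x * h x l = 0}.
    by apply: density_ae_comb ih hE _ => B mB; rewrite mul0e alternating_mu0.
  apply => l hl _; rewrite fourierE; under eq_bigr do rewrite mulrC.
  by rewrite hl mulr0.
have hSs : {ae m, forall l S, oblivious_family S -> fourier (h ^~ l) S = 0}.
  exact: filter_forall hS.
apply: filterS2 h1 hSs => l hl1 hlS.
apply: (@success_le _ _ (h ^~ l) (fun M k => xi (o := O) (hm_out H k) l)) => //.
- by move=> M k; exact: xi_ge0.
- by move=> M; exact: response_sum1.
Qed.
End upper_bound.

(** * Theories with finitely many ontological states and deterministic responses *)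

(** The base point is a parameter of the alias so that the pointed structure can use it; every
    subset is declared measurable. *)
Definition discrete (A : choiceType) (a0 : A) : Type := A.

Section discrete_instances.
Variables (A : choiceType) (a0 : A).
HB.instance Definition _ := Choice.on (discrete a0).
HB.instance Definition _ := isPointed.Build (discrete a0) a0.
HB.instance Definition _ :=
  @isMeasurable.Build default_measure_display (discrete a0)
    (@discrete_measurable (discrete a0)) (@discrete_measurable0 (discrete a0))
    (@discrete_measurableC (discrete a0)) (@discrete_measurableU (discrete a0)).
End discrete_instances.

Section finite_measure_of_weights.
Context (R : realType) (A : finType) (a0 : A) (w : A -> R).
Hypothesis w_distr : is_distr w.

Let w_ge0 a : 0 <= w a. Proof. by case: w_distr. Qed.

Let pt k := nth a0 (enum A) k.

Let sum_pt (F : A -> \bar R) : (\sum_a F a = \sum_(k < #|A|) F (pt k))%E.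
Proof. by rewrite -big_enum (big_nth a0) -cardE big_mkord. Qed.

(** A combination of Dirac masses. [msum] is indexed by naturals, hence the enumeration [pt], whose
    default value is never reached. *)
Definition weighted : set (discrete a0) -> \bar R :=
  msum (fun k : nat => mscale (NngNum (w_ge0 (pt k))) (\d_(pt k : discrete a0)))
    #|A|.

HB.instance Definition _ := Measure.on weighted.

Lemma weightedE B : (weighted B = \sum_a (w a)%:E * \d_(a : discrete a0) B)%E.
Proof.
by rewrite (sum_pt (fun a => _ * \d_(a : discrete a0) B)%E).
Qed.

Lemma weighted_setT : weighted setT = 1%E.
Proof.
rewrite weightedE -(proj2 w_distr) -sumEFin.
by apply: eq_bigr => a _; rewrite diracT mule1.
Qed.

HB.instance Definition _ :=
  @Measure_isProbability.Build _ _ _ weighted weighted_setT.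

Definition weighted_prob : probability (discrete a0) R := weighted.

Lemma integral_weighted (f : discrete a0 -> R) : (forall a, 0 <= f a) ->
  (\int[weighted_prob]_a (f a)%:E = (\sum_a w a * f a)%:E)%E.
Proof.
move=> f0; have f0E (a : discrete a0) : setT a -> (0 <= (f a)%:E)%E.
  by rewrite lee_fin.
rewrite /weighted_prob /weighted/= ge0_integral_measure_sum//.
transitivity (\sum_(k < #|A|) (w (pt k))%:E * (f (pt k))%:E)%E.
  apply: eq_bigr => k _; rewrite ge0_integral_mscale//.
  by rewrite integral_dirac// diracT mul1e.
by rewrite -sumEFin sum_pt; apply: eq_bigr => k _; rewrite EFinM.
Qed.
End finite_measure_of_weights.

Section deterministic_theory.
Context (R : realType) (A : finType) (a0 : A).
Context (I : Type) (K : I -> finType) (resp : forall i, A -> K i).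

Definition weights := {w : A -> R | is_distr w}.

Lemma is_distr_point : is_distr (fun a : A => (a == a0)%:R : R).
Proof.
split=> [a|]; first exact: ler0n.
by rewrite (bigD1 a0)//= eqxx big1 ?addr0// => a /negPf ->.
Qed.

Definition mix_fun (B : finType) (v : B -> R) (P : B -> weights) (a : A) : R :=
  \sum_b v b * sval (P b) a.

Lemma is_distr_mix (B : finType) (v : B -> R) (P : B -> weights) :
  is_distr v -> is_distr (mix_fun v P).
Proof.
move=> [v0 v1]; split=> [a|].
  by apply: sumr_ge0 => b _; rewrite mulr_ge0//; case: (P b) => w [].
rewrite exchange_big -v1; apply: eq_bigr => b _ /=.
by rewrite -mulr_sumr; case: (P b) => w [_ /= ->]; rewrite mulr1.
Qed.

(* When [v] is not a distribution, the mixture is the junk value [a0]. *)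
Definition mix_weights (B : finType) (v : B -> R) (P : B -> weights) : weights :=
  match pselect (is_distr v) with
  | left v_distr => exist _ _ (is_distr_mix P v_distr)
  | right _ => exist _ _ is_distr_point
  end.

Lemma mix_weightsE (B : finType) (v : B -> R) (P : B -> weights) :
  is_distr v -> sval (mix_weights v P) = mix_fun v P.
Proof. by rewrite /mix_weights; case: pselect. Qed.

Definition det_xi i (k : K i) (a : A) : R := (resp i a == k)%:R.

Definition det_prob (w : weights) i (k : K i) : R := \sum_a sval w a * det_xi k a.

Lemma det_xi_sum1 i a : \sum_(k : K i) det_xi k a = 1.
Proof.
rewrite (bigD1 (resp i a))//= /det_xi eqxx big1 ?addr0// => k /negPf.
by rewrite eq_sym => ->.
Qed.

Lemma det_prob_ge0 w i (k : K i) : 0 <= det_prob w k.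
Proof. by apply: sumr_ge0 => a _; rewrite mulr_ge0//; case: w => w []. Qed.

Lemma det_prob_sum1 w i : (\esum_(k in [set: K i]) (det_prob w k)%:E = 1)%E.
Proof.
rewrite esum_finType => [|k]; last exact: det_prob_ge0.
rewrite exchange_big/= -(proj2 (svalP w)); congr EFin; apply: eq_bigr => a _.
by rewrite -mulr_sumr det_xi_sum1 mulr1.
Qed.

Lemma det_prob_mix (B : finType) (v : B -> R) (P : B -> weights) : is_distr v ->
  forall i (k : K i), det_prob (mix_weights v P) k = \sum_b v b * det_prob (P b) k.
Proof.
move=> v_distr i k; rewrite /det_prob mix_weightsE//.
under eq_bigr do rewrite mulr_suml.
rewrite exchange_big; apply: eq_bigr => b _; rewrite mulr_sumr.
by apply: eq_bigr => a _; rewrite mulrA.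
Qed.

Definition det_theory : op_theory R :=
  OpTheory (Out := fun i => K i) det_prob_ge0 det_prob_sum1 det_prob_mix.

Definition det_mu (w : weights) := weighted_prob a0 (svalP w).

Lemma det_mu_mix (B : finType) (v : B -> R) (P : B -> weights) : is_distr v ->
  forall C, measurable C ->
    (det_mu (mix_weights v P) C = \sum_b (v b)%:E * det_mu (P b) C)%E.
Proof.
move=> v_distr C _; rewrite [LHS]weightedE mix_weightsE//.
transitivity (\sum_b \sum_a (v b * sval (P b) a)%:E * \d_(a : discrete a0) C)%E.
  rewrite exchange_big; apply: eq_bigr => a _.
  rewrite /mix_fun -sumEFin ge0_sume_distrl// => b _.
  by rewrite lee_fin mulr_ge0//; [case: v_distr|case: (P b) => w []].
apply: eq_bigr => b _; rewrite [det_mu _ _]weightedE ge0_sume_distrr.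
  by apply: eq_bigr => a _; rewrite EFinM muleA.
by move=> a _; rewrite mule_ge0// lee_fin; case: (P b) => w [].
Qed.

Definition det_model : ontological_model det_theory.
Proof.
refine (@OntologicalModel R det_theory _ (discrete a0) det_mu
  (fun i k a => det_xi k a) _ _ _ _ det_mu_mix _).
(* Every function on a discrete space is measurable. *)
- by [].
- by move=> i k a; exact: ler0n.
- by move=> i k a; rewrite /det_xi; case: eqP => _; rewrite ?ler01.
- by move=> i a; rewrite esum_finType ?det_xi_sum1.
- by move=> w i k; rewrite integral_weighted.
Defined.

(** When [resp i] is injective, the outcome [resp i a] has as its probability the weight of [a], so
    equivalent preparations have equal weights. *)
Lemma det_model_noncontextual (i : I) :
  injective (resp i) -> preparation_noncontextual det_model.
Proof.
move=> resp_inj w w' ww' B _; rewrite [LHS]weightedE [RHS]weightedE.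
apply: eq_bigr => a _; congr (_%:E * _)%E.
have prob_resp (u : weights) : det_prob u (resp i a) = sval u a.
  rewrite /det_prob (bigD1 a)//= /det_xi eqxx mulr1 big1 ?addr0// => b ba.
  by rewrite (inj_eq resp_inj) (negPf ba) mulr0.
by rewrite -!prob_resp; exact: ww'.
Qed.
End deterministic_theory.

(** * An optimal protocol *)

Section optimal_protocol.
Variables (R : realType) (n : nat) (g : cube n -> R).
Hypothesis g_K : K_set g.
Variable best : forall M : matching n, edge M.

Let g_ge0 x : 0 <= g x. Proof. by case: g_K. Qed.
Let g_mean : fourier g finset.set0 = 1. Proof. by case: g_K. Qed.

Definition hm_outcome (i : option (matching n)) : finType :=
  if i is Some M then (edge M * bool)%type else cube n.

(* [None] is the measurement that reveals the ontological state: it makes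
   operationally equivalent preparations equal. *)
Definition hm_response (i : option (matching n)) : cube n -> hm_outcome i :=
  match i with
  | Some M => fun l =>
      (best M, parity (val (best M)) l (+) (fourier g (val (best M)) < 0))
  | None => id
  end.

Definition hm_theory : op_theory R :=
  det_theory R ([ffun=> false] : cube n) hm_response.

(** The law of x + y, with y drawn with probability g(y)/2^n. *)
Definition shifted (x l : cube n) : R := (2 ^+ n)^-1 * g (cube_add x l).

Lemma is_distr_shifted x : is_distr (shifted x).
Proof.
split=> [l|]; first by rewrite mulr_ge0// invr_ge0 exprn_ge0.
rewrite -mulr_sumr -[RHS]g_mean fourier_set0E; congr (_ * _).
by rewrite [in RHS](reindex_inj (inv_inj (cube_addK x))).
Qed.

Definition shift_protocol : HM_protocol hm_theory n :=
  @HMProtocol R hm_theory n (fun x => exist _ _ (is_distr_shifted x))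
    (@Some _) (fun M k => k) (fun M => Bijective (frefl id) (frefl id)).

(** The two mixtures agree at each state [l]: the alternating sum of g(x + l) over x is a multiple
    of the coefficient of [g] at [S], which vanishes. *)
Lemma shift_protocol_oblivious : parity_oblivious shift_protocol.
Proof.
move=> S Sobl i k; rewrite /= /det_prob.
have S0 : S != finset.set0 by case/andP: Sobl; rewrite cards_eq0.
rewrite !mix_weightsE; try exact: is_distr_unif_parity.
apply: eq_bigr => l _; congr (_ * _); apply/eqP; rewrite -subr_eq0 -sumrB.
under eq_bigr do rewrite -mulrBl unif_parity_sub// -mulrA.
rewrite -mulr_sumr mulf_eq0; apply/orP; right; rewrite /= /shifted.
rewrite (reindex_inj (inv_inj (cube_addK l)))/=.
have [_ _ /(_ S Sobl) gS0] := g_K; apply/eqP.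
transitivity ((-1) ^+ parity S l * fourier g S); last by rewrite gS0 mulr0.
rewrite fourierE !mulr_sumr; apply: eq_bigr => x _.
rewrite [cube_add (cube_add _ _) _]cube_addC cube_addK parity_add signr_addb.
by ring.
Qed.

(** The answer always names [best M]. Writing l = x + y, its bit is right exactly when y has parity
    [s] on that edge; this removes x, and [s] turns the coefficient into its absolute value. *)
Lemma success_shift_edge (M : matching n) (x : cube n) :
  \sum_(e : edge M) prob hm_theory (hm_prep shift_protocol x) (Some M)
      (e, parity (val e) x)
    = 1 / 2 + 1 / 2 * `|fourier g (val (best M))|.
Proof.
set b := best M; set s := fourier g (val b) < 0.
transitivity (\sum_l shifted x l * (parity (val b) l (+) s == parity (val b) x)%:R).
  rewrite exchange_big; apply: eq_bigr => l _ /=.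
  rewrite (bigD1 b)//= big1 => [|e /negPf eb].
    by rewrite addr0 /det_xi xpair_eqE eqxx.
  by rewrite /det_xi xpair_eqE eq_sym eb mulr0.
rewrite (reindex_inj (inv_inj (cube_addK x))).
transitivity ((2 ^+ n)^-1 * \sum_y g y * (parity (val b) y == s)%:R).
  rewrite mulr_sumr; apply: eq_bigr => y _.
  rewrite /shifted cube_addK -mulrA parity_add; congr (_ * (_ * (nat_of_bool _)%:R)).
  by case: (parity _ x) (parity _ y) s => [] [] [].
rewrite mean_parity_eq// (_ : _ ^+ s * _ = `|fourier g (val b)|); first by field.
by rewrite /s; case: ltrP => [/ltr0_norm|/ger0_norm] ->; rewrite ?mulN1r ?mul1r.
Qed.

Lemma success_shift_protocol : (0 < #|{: matching n}|)%N ->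
  (forall M : matching n,
      \big[Num.max/0]_(e in val M) `|fourier g e| = `|fourier g (val (best M))|) ->
  success_prob shift_protocol = 1 / 2 + 1 / 2 * Phi g.
Proof.
move=> N_gt0 bestE; rewrite /success_prob -mulr_sumr.
have N0 : #|{: matching n}|%:R != 0 :> R by rewrite pnatr_eq0 -lt0n.
under eq_bigr do under eq_bigr do rewrite success_shift_edge -bestE.
rewrite sumr_const card_ffun card_bool card_ord -[X in _ * (_ * X)]mulr_natl natrX.
rewrite mulrCA mulKf ?expf_neq0 ?pnatr_eq0// big_split/= sumr_const -mulr_sumr.
by rewrite -[X in _ * (X + _)]mulr_natl mulrDr mulKf// mulrCA.
Qed.
End optimal_protocol.

(** * Equality of the two bounds *)

Theorem proposition1 (R : realType) (n : nat) (n_gt0 : (0 < n)%N)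
    (n_even : ~~ odd n) :
  p_NC_opt R n = 1 / 2 + 1 / 2 * R_max R n.
Proof.
have N_gt0 : (0 < #|{: matching n}|)%N.
  have [M pM] := perfect_matching_exists n_even; apply/card_gt0P.
  by exists (exist _ M pM).
have [g g_K [gE _]] := R_max_attained R n.
(* Since [n] is positive, each matching has an edge, so the maximum is attained at an edge and not
   only by the base value 0. *)
have /fin_all_exists[best bestE] (M : matching n) : exists e : edge M,
    \big[Num.max/0]_(e in val M) `|fourier g e| = `|fourier g (val e)|.
  have [e0 e0M] := perfect_matching_nonempty M n_gt0.
  have [e eM ->] := bigmax_attained e0M (fun e => normr_ge0 (fourier g e)).
  by exists (exist _ e eM).
rewrite /p_NC_opt; set V := mkset _.
have V_ub : ubound V (1 / 2 + 1 / 2 * R_max R n).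
  by move=> _ [T [[om om_nc] [H H_po ->]]]; exact: (success_prob_le om_nc H_po).
have V_max : V (1 / 2 + 1 / 2 * R_max R n).
  exists (hm_theory g best); split.
    (* The response of [None] is the identity, hence injective. *)
    eexists; exact: (@det_model_noncontextual _ _ _ _ _ _ None).
  exists (shift_protocol g_K best); first exact: shift_protocol_oblivious.
  by rewrite success_shift_protocol ?gE.
(* The bound is the greatest element of [V]; this also supplies the nonemptiness and boundedness on
   which [sup] depends. *)
apply/le_anti/andP; split; first by apply: ge_sup => //; eexists; exact: V_max.
by apply: ub_le_sup => //; eexists; exact: V_ub.
Qed.
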